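(* Let $(\mathscr G_0,\mathscr G_1)$ be uncertainty classes for which an asymptotically minimax robust (AMR) solution exists. Let $(\overline G_0,\overline G_1)$ be the AMR least favorable distributions corresponding to the minimizing parameter $u^*\in(0,1)$, i.e. they maximize $D_{u^*}$ over $\mathscr G_0\times\mathscr G_1$. Assume that the maximization of $D_{u^*}$ over $\mathscr G_0\times\mathscr G_1$ admits a unique solution (up to $\mu$-a.e. equality of densities). If a finite-sample minimax robust (FMR) test exists for the same uncertainty classes, then its least favorable distributions coincide $\mu$-a.e. with $(\overline G_0,\overline G_1)$. Thus, whenever an FMR test exists, AMR $\Longrightarrow$ FMR.
   Context: $\mathscr G_0,\mathscr G_1$ are sets of probability measures on $\Omega$, absolutely continuous with respect to a common measure $\mu$; the density of $G_j$ is $g_j$. For $u\in(0,1)$ the $u$-affinity is $D_u(G_0,G_1)=\int_\Omega g_1^u g_0^{1-u}\,d\mu$. AMR solution: a solution of the minimax problem $\min_{u\in(0,1)}\max_{(G_0,G_1)\in\mathscr G_0\times\mathscr G_1}D_u(G_0,G_1)$; $u^*$ denotes the minimizing parameter, and the AMR least favorable distributions are the pair maximizing $D_{u^*}$. FMR test: for a pair $(\hat G_0,\hat G_1)\in\mathscr G_0\times\mathscr G_1$ (the least favorable distributions of the test) put $\hat l=\hat g_1/\hat g_0$. The likelihood ratio test induced by $(\hat G_0,\hat G_1)$ is FMR if for every finite $n$, with $Y_1,\dots,Y_n$ i.i.d. from $G_j$ under hypothesis $j$, $$G_0\Big[\prod_{k=1}^n\hat l(Y_k)<t\Big]\ge\hat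 G_0\Big[\prod_{k=1}^n\hat l(Y_k)<t\Big],\qquad G_1\Big[\prod_{k=1}^n\hat l(Y_k)<t\Big]\le\hat G_1\Big[\prod_{k=1}^n\hat l(Y_k)<t\Big]$$ for all $t\in\mathbb R$ and all $(G_0,G_1)\in\mathscr G_0\times\mathscr G_1$. *)

(* Defs.v *)
From HB Require Import structures.
From mathcomp Require Import all_boot all_order all_algebra.
From mathcomp Require Import all_classical all_reals all_analysis.
From mathcomp Require Import measurable_realfun.

Set Implicit Arguments.
Unset Strict Implicit.
Unset Printing Implicit Defensive.

Import Order.TTheory GRing.Theory Num.Theory.
Import numFieldNormedType.Exports.

Local Open Scope classical_set_scope.
Local Open Scope ring_scope.

Section densities.
Context (d : measure_display) (Omega : measurableType d) (R : realType).
Variable mu : {measure set Omega -> \bar R}.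

Definition is_density (G : probability Omega R) (g : Omega -> R) : Prop :=
  [/\ measurable_fun [set: Omega] g, (forall x, 0 <= g x) &
      forall A, measurable A -> G A = (\int[mu]_(x in A) (g x)%:E)%E].

(* The existence of a density is implied by `G `<< mu` when mu is sigma-finite
   (Radon-Nikodym); requiring it separately allows an arbitrary mu. *)
Definition dominated (GG : set (probability Omega R)) : Prop :=
  forall G, GG G -> G `<< mu /\ exists g, is_density G g.

(* A version of the density; it is the null function if there is none. *)
Definition density (G : probability Omega R) : Omega -> R :=
  xget (cst 0) [set g | is_density G g].

Definition affinity (u : R) (G0 G1 : probability Omega R) : \bar R :=
  (\int[mu]_x (density G1 x `^ u * density G0 x `^ (1 - u))%:E)%E.

End densities.

Section amr.
Context (d : measure_display) (Omega : measurableType d) (R : realType).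
Variable mu : {measure set Omega -> \bar R}.
Variables GG0 GG1 : set (probability Omega R).

Definition maximizes_affinity (u : R) (G0 G1 : probability Omega R) : Prop :=
  [/\ GG0 G0, GG1 G1 &
      forall H0 H1, GG0 H0 -> GG1 H1 ->
        (affinity mu u H0 H1 <= affinity mu u G0 G1)%E].

(* A supremum, so that the inner maximum need only be attained at the
   minimizing parameter. *)
Definition max_affinity (u : R) : \bar R :=
  ereal_sup [set affinity mu u G.1 G.2 | G in GG0 `*` GG1].

Definition is_AMR (u : R) (G0 G1 : probability Omega R) : Prop :=
  [/\ 0 < u < 1,
      forall v, 0 < v < 1 -> (max_affinity u <= max_affinity v)%E &
      maximizes_affinity u G0 G1].

Definition unique_maximizer (u : R) : Prop :=
  forall G0 G1 H0 H1,
    maximizes_affinity u G0 G1 -> maximizes_affinity u H0 H1 ->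
    ae_eq mu [set: Omega] (density mu G0) (density mu H0) /\
    ae_eq mu [set: Omega] (density mu G1) (density mu H1).

End amr.

Section iid.
Context (d : measure_display) (Omega : measurableType d) (R : realType).

Definition cons_pair (n : nat) (p : Omega * n.-tuple Omega) : n.+1.-tuple Omega :=
  [tuple of p.1 :: p.2].

Lemma measurable_cons_pair (n : nat) :
  measurable_fun [set: Omega * n.-tuple Omega] (@cons_pair n).
Proof. exact: measurable_cons. Qed.

HB.instance Definition _ (n : nat) :=
  isMeasurableFun.Build _ _ _ _ (@cons_pair n) (@measurable_cons_pair n).

(* The law of (Y_1, ..., Y_n), with Y_1, ..., Y_n i.i.d. from G: the n-fold
   product measure of G. *)
Fixpoint iid_law (G : probability Omega R) (n : nat) :
    probability (n.-tuple Omega) R :=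
  match n with
  | 0 => \d_ [tuple]
  | n'.+1 => distribution (G \x iid_law G n')%E (@cons_pair n')
  end.

End iid.

Section fmr.
Context (d : measure_display) (Omega : measurableType d) (R : realType).
Variable mu : {measure set Omega -> \bar R}.

(* l = g1 / g0 with values in [0, +oo]: here a / 0 = +oo for a > 0, and l may
   take any value where g0 and g1 both vanish. *)
Definition is_likelihood_ratio (G0 G1 : probability Omega R)
    (l : Omega -> \bar R) : Prop :=
  [/\ measurable_fun [set: Omega] l, (forall x, 0 <= l x)%E &
      {ae mu, forall x, (density mu G0 x != 0) || (density mu G1 x != 0) ->
        l x = ((density mu G1 x)%:E / (density mu G0 x)%:E)%E}].

(* The convention 0 * +oo = 0 is immaterial: the inequalities for n = 1 make
   l = +oo null under the first hypothesis and l = 0 null under the second. *)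
Definition product_below (l : Omega -> \bar R) (n : nat) (t : R) :
    set (n.-tuple Omega) :=
  [set y | (\prod_(k < n) l (tnth y k) < t%:E)%E].

(* The likelihood ratio test induced by (Ghat0, Ghat1), with statistic l, is
   FMR over (GG0, GG1). *)
Definition is_FMR (GG0 GG1 : set (probability Omega R))
    (Ghat0 Ghat1 : probability Omega R) (l : Omega -> \bar R) : Prop :=
  [/\ GG0 Ghat0, GG1 Ghat1, is_likelihood_ratio Ghat0 Ghat1 l &
      forall (n : nat) (t : R) (G0 G1 : probability Omega R),
        GG0 G0 -> GG1 G1 ->
        (iid_law Ghat0 n (product_below l t)
           <= iid_law G0 n (product_below l t))%E /\
        (iid_law G1 n (product_below l t)
           <= iid_law Ghat1 n (product_below l t))%E].

End fmr.

(* Main.v *)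
Require Import Defs.
From mathcomp Require Import all_boot all_order all_algebra.
From mathcomp Require Import all_classical all_reals all_analysis.
From mathcomp Require Import measurable_realfun.
From mathcomp Require Import lra.

(* The inequalities for n = 1 already say that l is stochastically largest
   under Ghat0 among all G0, and stochastically smallest under Ghat1 among all
   G1.  By the weighted arithmetic-geometric mean inequality
     g1^u g0^(1-u) <= u g1 l^(u-1) + (1-u) g0 l^u,
   with equality when l = g1/g0.  Integrating, the affinity of (G0, G1) is at
   most u E_G1[l^(u-1)] + (1-u) E_G0[l^u]; both expectations increase when
   (G0, G1) is replaced by (Ghat0, Ghat1), and then equal the affinity of
   (Ghat0, Ghat1).  So (Ghat0, Ghat1) maximizes the u-affinity, for every u,
   and uniqueness of the maximizer at u* concludes. *)

Local Open Scope classical_set_scope.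
Local Open Scope ring_scope.
Set Implicit Arguments.
Unset Strict Implicit.
Unset Printing Implicit Defensive.
Import Order.TTheory GRing.Theory Num.Theory.
Import numFieldNormedType.Exports.

(** * Powers of a likelihood ratio and the weighted arithmetic-geometric mean inequality *)

Section likelihood_ratio_powers.
Context (R : realType).
Implicit Types a b u : R.

(** Evaluates the integrand l^u g0 at l = b / a. At a = 0 both sides vanish: the left one because
    +oo * 0 = 0, the right one because 1 - u is nonzero. *)
Lemma likelihood_ratio_power a b u : 0 <= a -> 0 <= b -> 0 < u < 1 ->
  ((b%:E / a%:E) `^ u * a%:E = (b `^ u * a `^ (1 - u))%:E)%E.
Proof.
move=> a0 b0 /andP[u0 u1]; have [->|aN0] := eqVneq a 0.
  by rewrite mule0 powR0 ?mulr0// subr_eq0 gt_eqF.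
have agt0 : 0 < a by rewrite lt_neqAle eq_sym aN0.
rewrite inver (negbTE aN0) -!EFinM; congr EFin.
rewrite powRM ?invr_ge0// -mulrA; congr (_ * _).
rewrite -powR_inv1// -powRrM mulN1r addrC powRD ?aN0 ?implybT//.
by rewrite powRr1.
Qed.

(** Exchanging the two hypotheses inverts the ratio. At a = b = 0 this would fail: 0 / 0 is 0, and
    its inverse is +oo. *)
Lemma inve_likelihood_ratio a b : 0 <= a -> 0 <= b -> (a != 0) || (b != 0) ->
  ((b%:E / a%:E)^-1 = a%:E / b%:E)%E.
Proof.
rewrite !le0r; case: (eqVneq a 0) => [->|aN0] /= a0;
    case: (eqVneq b 0) => [->|bN0] //= b0 _.
- by rewrite inve0 gt0_muley ?lte_fin// invey mul0e.
- by rewrite mul0e inve0 gt0_muley ?lte_fin.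
- by rewrite !inver (negbTE aN0) (negbTE bN0) -!EFinM inver mulf_eq0 invr_eq0
    (negbTE aN0) (negbTE bN0) invf_div.
Qed.

(** Young's inequality with exponents 1/u and 1/(1-u), after splitting the left side into two
    factors whose powers of r cancel. *)
Lemma weighted_AGM a b (r : R) u : 0 <= a -> 0 <= b -> 0 < r -> 0 < u < 1 ->
  b `^ u * a `^ (1 - u) <=
  u * (r^-1 `^ (1 - u) * b) + (1 - u) * (r `^ u * a).
Proof.
move=> a0 b0 r0 /andP[u0 u1]; have v0 : 0 < 1 - u by rewrite subr_gt0.
have /le_trans : b `^ u * a `^ (1 - u) <=
    (r^-1 `^ (1 - u) * b) `^ u * (r `^ u * a) `^ (1 - u).
  rewrite !powRM ?powR_ge0// [leRHS]mulrACA.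
  rewrite -!powRrM (mulrC u) -powRM ?invr_ge0 ?(ltW r0)// mulVf ?gt_eqF//.
  by rewrite powR1 mul1r.
apply.
have := @conjugate_powR R ((r^-1 `^ (1 - u) * b) `^ u)
  ((r `^ u * a) `^ (1 - u)) u^-1 (1 - u)^-1.
rewrite !powR_ge0 !invr_gt0 !invrK -!powRrM !mulfV ?gt_eqF//.
rewrite !powRr1 ?mulr_ge0 ?powR_ge0//.
by rewrite ![_ * u]mulrC ![_ * (1 - u)]mulrC; apply => //; rewrite subrKC.
Qed.

(* At e = 0 and e = +oo the bound relies on 0 * +oo = 0. *)
Lemma weighted_AGMe a b (e : \bar R) u :
  0 <= a -> 0 <= b -> (0 <= e)%E -> 0 < u < 1 ->
  ((b `^ u * a `^ (1 - u))%:E <=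
   u%:E * (e^-1 `^ (1 - u) * b%:E) + (1 - u)%:E * (e `^ u * a%:E))%E.
Proof.
move=> a0 b0 e0 u01; have /andP[u0 u1] := u01; have v0 : 0 < 1 - u by lra.
have uN0 := gt_eqF u0; have vN0 := gt_eqF v0.
have nneg : (0 <= u%:E * (e^-1 `^ (1 - u) * b%:E) +
                  (1 - u)%:E * (e `^ u * a%:E))%E.
  by rewrite adde_ge0 ?mule_ge0 ?poweR_ge0 ?lee_fin// ltW.
case: e e0 nneg => [r| |]//.
  rewrite lee_fin le_eqVlt => /predU1P[<- nneg|r0 _].
    (* At e = 0 the first term is +oo, unless b = 0, and then the left side is 0. *)
    move: b0; rewrite le_eqVlt => /predU1P[b0|b0].
      by move: nneg; rewrite -b0 powR0 ?uN0// mul0r.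
    rewrite inve0 poweRyr ?vN0// gt0_mulye ?lte_fin// gt0_muley ?lte_fin//.
    by rewrite addye ?leey// poweR_EFin powR0 ?uN0// mul0e mule0.
  rewrite inver gt_eqF// !poweR_EFin -!EFinM -EFinD lee_fin.
  exact: weighted_AGM.
(* At e = +oo the second term is +oo, unless a = 0, and then the left side is 0. *)
move=> _ nneg; move: a0; rewrite le_eqVlt => /predU1P[a0|a0].
  by move: nneg; rewrite -a0 powR0 ?vN0// mulr0.
rewrite invey poweRyr ?uN0// gt0_mulye ?lte_fin// gt0_muley ?lte_fin//.
by rewrite addey ?leey// poweR_EFin powR0 ?vN0// mul0e mule0.
Qed.

End likelihood_ratio_powers.

(** * Comparing integrals through level sets *)

Section levels.
Context (d : measure_display) (T : measurableType d) (R : realType).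

(** Tonelli: both integrals are product measures of E, and integrating in the other order leaves
    only the measures of the horizontal sections to compare. *)
Lemma le_integral_sections (P Q : probability T R)
    (E : set (T * measurableTypeR R)) (f : T -> \bar R) :
  measurable E -> (forall x, f x = lebesgue_measure (xsection E x)) ->
  (forall s, (P (ysection E s) <= Q (ysection E s))%E) ->
  (\int[P]_x f x <= \int[Q]_x f x)%E.
Proof.
move=> mE fE PQ.
have swap (m : probability T R) :
    (\int[m]_x f x = \int[lebesgue_measure]_s m (ysection E s))%E.
  transitivity ((m \x (@lebesgue_measure R))%E E).
    by rewrite /product_measure1; apply: eq_integral => x _ /=.
  rewrite (@product_measure_unique _ _ _ _ _ _ _
    (m \x^ (@lebesgue_measure R))%E)//.
  by move=> A B mA mB; exact: product_measure2E.
rewrite !swap; apply: ge0_le_integral => //.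
exact: measurable_fun_ysection.
exact: measurable_fun_ysection.
Qed.

(* Layer cake: f x is the length of {s > 0 | s < f x}, and also that of
   {s > 0 | s <= f x}. *)
Lemma le_integral_levels (b : bool) (P Q : probability T R) (f : T -> \bar R) :
  measurable_fun setT f -> (forall x, 0 <= f x)%E ->
  (forall s : R, 0 < s -> (P [set x | (s%:E < f x ?<= if b)%O] <=
                           Q [set x | (s%:E < f x ?<= if b)%O])%E) ->
  (\int[P]_x f x <= \int[Q]_x f x)%E.
Proof.
move=> mf f0 PQ.
(* The region under the graph of f, containing the graph where f > 0 exactly when b is true. *)
pose E : set (T * measurableTypeR R) :=
  [set z | 0 < z.2 /\ (z.2%:E < f z.1 ?<= if b)%O].
apply: (@le_integral_sections _ _ E).
- have m2 : measurable_fun setT (fun z : T * measurableTypeR R => (z.2 : R)%:E).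
    exact/measurable_EFinP.
  have m1 : measurable_fun setT (fun z : T * measurableTypeR R => f z.1).
    exact: measurableT_comp.
  have -> : E = [set z | 0 < (z.2 : R)%:E]%E `&`
                [set z | ((z.2 : R)%:E < f z.1 ?<= if b)%O].
    by apply/seteqP; split => z /=; rewrite lte_fin.
  apply: measurableI.
    rewrite -[X in measurable X]setTI.
    exact: (emeasurable_fun_o_infty measurableT m2).
  rewrite -[X in measurable X]setTI; case: (b) => /=.
    exact: (measurable_lee measurableT m2 m1).
  exact: (measurable_lte measurableT m2 m1).
(* The vertical section runs from 0 to f x; [BSide (~~ b) r] includes the endpoint r exactly when b
   is true, which does not affect the length. *)
- move=> x; pose ub := if f x is r%:E then BSide (~~ b) r else +oo%O.
  have -> : xsection E x = [set` Interval (BRight 0) ub].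
    apply/seteqP; split => s; rewrite /xsection/= inE /E/= in_itv/= /ub;
      move: (f0 x); case: (f x) => [r| |] //=.
    - by rewrite negbK => _ [-> /=]; case: (b).
    - by move=> _ [->].
    - by rewrite negbK => _ /andP[-> /=]; case: (b).
    - by rewrite andbT => _ ->; case: (b); rewrite /= ?leey ?ltry.
  rewrite lebesgue_measure_itv/= /ub; move: (f0 x).
  case: (f x) => [r| |] //=; rewrite ?lte_fin ?lee_fin.
    by rewrite le_eqVlt => /predU1P[<-|r0]; rewrite ?ltxx ?r0 ?sube0.
  by rewrite ltry oppr0 adde0.
- move=> s; have [s0|s0] := ltP 0 s.
    have -> : ysection E s = [set x | (s%:E < f x ?<= if b)%O].
      apply/seteqP; split => x; rewrite /ysection/= inE /E/=; first by case.
      by [].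
    exact: PQ.
  have -> : ysection E s = set0.
    apply/seteqP; split => x //; rewrite /ysection/= inE /E/= ltNge s0.
    by case.
  by rewrite !measure0.
Qed.

End levels.

(** * Level sets of powers *)

Section levels_power.
Context (R : realType).

Lemma ge0_ltr_powRE (a x y : R) : 0 < a -> 0 <= x -> 0 <= y ->
  (x `^ a < y `^ a) = (x < y).
Proof.
move=> a0 x0 y0; apply/idP/idP; last exact: gt0_ltr_powR.
by rewrite !ltNge; apply: contra; apply: ge0_ler_powR => //; exact: ltW.
Qed.

Lemma lteif_poweRr (b : bool) (a s : R) (e : \bar R) :
  0 < a -> 0 < s -> (0 <= e)%E ->
  (s%:E < (e `^ a)%E ?<= if b)%O = ((s `^ a^-1)%:E < e ?<= if b)%O.
Proof.
move=> a0 s0; have {1}-> : s = (s `^ a^-1) `^ a.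
  by rewrite -powRrM mulVf ?gt_eqF// powRr1// ltW.
case: e => [r| |]//= r0; last first.
  by rewrite gt_eqF//; case: b; rewrite /= ?leey ?ltry.
case: b; rewrite /= ?lee_fin ?lte_fin 1?leNgt ge0_ltr_powRE ?powR_ge0//.
by rewrite -leNgt.
Qed.

End levels_power.

(** * Integration against a probability given by a density *)

Section density_theory.
Context (d : measure_display) (T : measurableType d) (R : realType).

(** Inversion reverses the order on [0, +oo], so the ray above r pulls back to {f < 1/r}, with 1/0 =
    +oo, or to the whole space when r < 0. *)
Lemma measurable_inve (f : T -> \bar R) :
  measurable_fun setT f -> (forall x, 0 <= f x)%E ->
  measurable_fun setT (fun x => (f x)^-1)%E.
Proof.
move=> mf f0 mT; apply: (measurability _ (ErealGenOInfty.measurableE R)) => //.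
move=> _ [_ [r ->] <-]; have [r0|r0] := ltP r 0.
  rewrite [X in measurable X](_ : _ = setT)//; apply/seteqP; split => x //= _.
  split => //; rewrite in_itv/= andbT.
  by rewrite (lt_le_trans _ (_ : 0 <= _)%E) ?lte_fin ?inve_ge0.
rewrite [X in measurable X](_ : _ = [set: T] `&` [set x | f x < r%:E^-1]%E).
  exact: emeasurable_fun_infty_o.
apply/seteqP; split => x /=; rewrite in_itv/= andbT => -[_];
  by rewrite inve_pgt ?inE ?lee_fin.
Qed.

Import HBNNSimple.

(** Here mu is an arbitrary measure, so the change of measure is derived from the formula for G A
    alone: first for simple functions, then by monotone convergence. *)
Lemma ge0_integral_density (mu : {measure set T -> \bar R})
    (G : probability T R) (g : T -> R) (f : T -> \bar R) :
  is_density mu G g -> measurable_fun setT f -> (forall x, 0 <= f x)%E ->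
  (\int[G]_x f x = \int[mu]_x (f x * (g x)%:E))%E.
Proof.
move=> [mg g0 Gg] mf f0; have mg' := proj2 (measurable_EFinP _ _) mg.
pose h := nnsfun_approx measurableT mf.
have mh n : measurable_fun setT (EFin \o h n) by exact/measurable_EFinP.
have hf x : (EFin \o h n) x @[n --> \oo] --> f x.
  by apply: cvg_nnsfun_approx.
have ndh x : {homo (fun n => (h n x)%:E) : n m / (n <= m)%N >-> (n <= m)%E}.
  by move=> n m nm; rewrite lee_fin; exact/lefP/nd_nnsfun_approx.
transitivity (limn (fun n => \int[G]_x (h n x)%:E)%E).
  rewrite -monotone_convergence//; last by move=> n x _; rewrite lee_fin.
  by apply: eq_integral => x _; apply/esym/cvg_lim => //; exact: hf.
transitivity (limn (fun n => \int[mu]_x ((h n x)%:E * (g x)%:E))%E); last first.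
  rewrite -monotone_convergence//; last first.
  - by move=> x _ n m nm; rewrite lee_wpmul2r ?lee_fin ?g0//; exact: ndh.
  - by move=> n x _; rewrite mule_ge0 ?lee_fin.
  - by move=> n; apply: emeasurable_funM; [exact: mh|exact: mg'].
  apply: eq_integral => x _; apply/cvg_lim => //.
  by apply: cvgeZr => //; exact: hf.
congr (limn _); apply/funext => n /=; move: (h n) => {mh hf ndh}h.
(* Write the simple function h as a finite sum of multiples of indicators of its fibres. *)
under [LHS]eq_integral do rewrite fimfunE -fsumEFin//.
under [RHS]eq_integral.
  move=> x _; rewrite fimfunE -fsumEFin// ge0_mule_fsuml; last first.
    by move=> r; rewrite EFinM; exact: nnfun_muleindic_ge0.
  over.
have mi r : measurable_fun setT (fun x => (r * \1_(h @^-1` [set r]) x)%:E).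
  exact/measurable_EFinP/measurable_funM.
rewrite !ge0_integral_fsum//; last first.
- by move=> r x _; rewrite EFinM; exact: nnfun_muleindic_ge0.
- move=> r x _; rewrite mule_ge0 ?lee_fin// -lee_fin EFinM.
  exact: nnfun_muleindic_ge0.
- by move=> r; exact: emeasurable_funM.
(* Only values r of h occur, so r is nonnegative and can leave both integrals. *)
apply: eq_fsbigr => r; rewrite inE => -[t _ ht].
have r0 : 0 <= r by rewrite -ht.
under eq_integral do rewrite EFinM.
under [RHS]eq_integral do rewrite EFinM -muleA.
rewrite !ge0_integralZl//; last first.
- exact/measurable_EFinP.
- by move=> x _; rewrite mule_ge0 ?lee_fin.
- apply: emeasurable_funM => //; exact/measurable_EFinP.
congr (_ * _)%E; rewrite integral_indic// setIT; apply: etrans (Gg _ _) _ => //.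
rewrite integral_mkcond.
by apply: eq_integral => x _; rewrite epatch_indic muleC.
Qed.

Lemma densityP (mu : {measure set T -> \bar R}) (GG : set (probability T R))
    (G : probability T R) :
  dominated mu GG -> GG G -> is_density mu G (density mu G).
Proof. by move=> dom /dom[_]; exact: xgetPex. Qed.

(** Used with non-strict levels of l under the first hypothesis and strict levels of 1/l under the
    second, to match the events {l < t} of the test. *)
Lemma le_integral_power (b : bool) (P Q : probability T R) (f : T -> \bar R)
    (a : R) :
  0 < a -> measurable_fun setT f -> (forall x, 0 <= f x)%E ->
  (forall s : R, 0 < s -> (P [set x | (s%:E < f x ?<= if b)%O] <=
                           Q [set x | (s%:E < f x ?<= if b)%O])%E) ->
  (\int[P]_x (f x `^ a) <= \int[Q]_x (f x `^ a))%E.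
Proof.
move=> a0 mf f0 PQ; apply: (@le_integral_levels _ _ _ b).
- exact: (measurableT_comp (measurable_poweR a)).
- by move=> x; exact: poweR_ge0.
move=> s s0.
rewrite (_ : [set x | _] = [set x | ((s `^ a^-1)%:E < f x ?<= if b)%O]).
  by apply: PQ; exact: powR_gt0.
by apply/seteqP; split => x /=; rewrite lteif_poweRr.
Qed.

End density_theory.

(** * Laws of i.i.d. samples *)

Section iid_law_theory.
Context (d : measure_display) (Omega : measurableType d) (R : realType).

Lemma measurable_product_below (l : Omega -> \bar R) (n : nat) (t : R) :
  measurable_fun setT l ->
  measurable (product_below l t : set (n.-tuple Omega)).
Proof.
move=> ml.
(* Inducting on a list of indices keeps the tuple length n fixed. *)
have mprod (s : seq 'I_n) :
    measurable_fun setT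
      (fun y : n.-tuple Omega => \prod_(k <- s) l (tnth y k))%E.
  elim: s => [|k s IHs].
    under eq_fun do rewrite big_nil.
    exact: measurable_cst.
  under eq_fun do rewrite big_cons; apply: emeasurable_funM => //.
  exact: (measurableT_comp ml (measurable_tnth k)).
rewrite -[X in measurable X]setTI.
exact: (emeasurable_fun_infty_o measurableT (mprod _)).
Qed.

Lemma iid_law1 (G : probability Omega R) (l : Omega -> \bar R) (t : R) :
  measurable_fun setT l ->
  iid_law G 1 (product_below l t) = G [set x | (l x < t%:E)%E].
Proof.
move=> ml; rewrite /= /pushforward.
(* The event is a rectangle whose second factor is the full space of empty tuples, of mass 1. *)
rewrite (_ : _ @^-1` _ = [set x | (l x < t%:E)%E] `*` setT); last first.
  apply/seteqP; split => -[x y] /=; rewrite /product_below /cons_pair/= big_ord1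
    (tnth_nth x)//=; by case.
transitivity (G [set x | (l x < t%:E)%E] *
    (\d_[tuple] : probability (0.-tuple Omega) R) setT)%E.
  apply: product_measure1E => //.
  rewrite -[X in measurable X]setTI; exact: emeasurable_fun_infty_o.
by rewrite probability_setT mule1.
Qed.

(** Densities determine a probability on measurable sets only, so the equality is carried to samples
    by uniqueness of product measures. *)
Lemma eq_iid_law (G H : probability Omega R) (n : nat)
    (A : set (n.-tuple Omega)) :
  (forall B, measurable B -> G B = H B) -> measurable A ->
  iid_law G n A = iid_law H n A.
Proof.
move=> GH; elim: n A => [//|n IHn] A mA /=; rewrite /pushforward.
have mB : measurable (@cons_pair d Omega n @^-1` A).
  rewrite -[X in measurable X]setTI; exact: measurable_cons_pair.
apply: product_measure_unique mB => B C mB mC.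
transitivity (H B * iid_law H n C)%E; first exact: product_measure1E.
by congr (_ * _)%E; [rewrite -[LHS]GH|rewrite -IHn].
Qed.

End iid_law_theory.

(** * Maximality of the affinity at the least favorable pair *)

Section affinity_of_LFD.
Context (d : measure_display) (Omega : measurableType d) (R : realType).
Context (mu : {measure set Omega -> \bar R}).

Lemma eq_density_measure (G H : probability Omega R) (g h : Omega -> R) :
  is_density mu G g -> is_density mu H h -> ae_eq mu setT g h ->
  forall A, measurable A -> G A = H A.
Proof.
move=> [mg g0 Gg] [mh h0 Hh] gh A mA; rewrite Gg// Hh//.
apply: ge0_ae_eq_integral => //.
- by apply/measurable_EFinP; exact: measurable_funTS.
- by apply/measurable_EFinP; exact: measurable_funTS.
- by move=> x _; rewrite lee_fin.
- by move=> x _; rewrite lee_fin.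
- by apply: filterS gh => x /(_ I) -> _.
Qed.

(** Lets one statistic l serve both the FMR pair and the AMR pair. *)
Lemma is_likelihood_ratio_ae_eq (G0 G1 H0 H1 : probability Omega R)
    (l : Omega -> \bar R) :
  ae_eq mu setT (density mu G0) (density mu H0) ->
  ae_eq mu setT (density mu G1) (density mu H1) ->
  is_likelihood_ratio mu G0 G1 l -> is_likelihood_ratio mu H0 H1 l.
Proof.
move=> e0 e1 [ml l0 lE]; split=> //.
by apply: filterS3 e0 e1 lE => x /(_ I) -> /(_ I) ->.
Qed.

Lemma measurable_affinity (G0 G1 : probability Omega R) (v : R) :
  is_density mu G0 (density mu G0) -> is_density mu G1 (density mu G1) ->
  measurable_fun setT
    (fun x => (density mu G1 x `^ v * density mu G0 x `^ (1 - v))%:E).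
Proof.
move=> [m0 _ _] [m1 _ _]; apply/measurable_EFinP; apply: measurable_funM.
  exact: (measurableT_comp (measurable_powR v) m1).
exact: (measurableT_comp (measurable_powR (1 - v)) m0).
Qed.

Section likelihood_ratio.
Context (H0 H1 : probability Omega R) (l : Omega -> \bar R) (u : R).
Context (u01 : 0 < u < 1).
Context (dH0 : is_density mu H0 (density mu H0)).
Context (dH1 : is_density mu H1 (density mu H1)).
Context (lr : is_likelihood_ratio mu H0 H1 l).

Let l0 x : (0 <= l x)%E. Proof. by case: lr. Qed.
Let il0 x : (0 <= (l x)^-1)%E. Proof. by rewrite inve_ge0. Qed.
Let ml : measurable_fun setT l. Proof. by case: lr. Qed.
Let mlu a : measurable_fun setT (fun x => l x `^ a)%E.
Proof. exact: (measurableT_comp (measurable_poweR a) ml). Qed.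
Let milu a : measurable_fun setT (fun x => (l x)^-1 `^ a)%E.
Proof.
exact: (measurableT_comp (measurable_poweR a) (measurable_inve ml l0)).
Qed.

Lemma affinity_likelihood_ratio0 :
  (\int[H0]_x (l x `^ u) = affinity mu u H0 H1)%E.
Proof.
have [m0 h0 _] := dH0; have [m1 h1 _] := dH1; have [_ _ lE] := lr.
rewrite (ge0_integral_density dH0)//; last by move=> x; exact: poweR_ge0.
apply: ge0_ae_eq_integral => //.
- by apply: emeasurable_funM => //; exact/measurable_EFinP.
- exact: measurable_affinity.
- by move=> x _; rewrite mule_ge0 ?poweR_ge0 ?lee_fin.
- by move=> x _; rewrite lee_fin mulr_ge0 ?powR_ge0.
apply: filterS lE => x lE _; rewrite -likelihood_ratio_power//.
(* Where both densities vanish l is arbitrary, but its power is multiplied by 0. *)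
have [h01|/norP[/negPn/eqP -> _]] :=
  boolP ((density mu H0 x != 0) || (density mu H1 x != 0)).
  by rewrite lE.
by rewrite !mule0.
Qed.

Lemma affinity_likelihood_ratio1 :
  (\int[H1]_x ((l x)^-1 `^ (1 - u)) = affinity mu u H0 H1)%E.
Proof.
have [m0 h0 _] := dH0; have [m1 h1 _] := dH1; have [_ _ lE] := lr.
have v01 : 0 < 1 - u < 1 by move: u01; lra.
rewrite (ge0_integral_density dH1)//; last by move=> x; exact: poweR_ge0.
apply: ge0_ae_eq_integral => //.
- by apply: emeasurable_funM => //; exact/measurable_EFinP.
- exact: measurable_affinity.
- by move=> x _; rewrite mule_ge0 ?poweR_ge0 ?lee_fin.
- by move=> x _; rewrite lee_fin mulr_ge0 ?powR_ge0.
apply: filterS lE => x lE _.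
(* The roles of the hypotheses are exchanged: 1 - u replaces u, and u is read as 1 - (1 - u). *)
rewrite mulrC -[X in _ * _ `^ X](subKr 1 u) -likelihood_ratio_power//.
have [h01|/norP[_ /negPn/eqP ->]] :=
  boolP ((density mu H0 x != 0) || (density mu H1 x != 0)).
  by rewrite lE// inve_likelihood_ratio.
by rewrite !mule0.
Qed.

(** The pair (H0, H1) plays the least favorable distributions; the bounds on {l < t} are the FMR
    inequalities for one observation. *)
Lemma affinity_le_LFD (G0 G1 : probability Omega R) :
  is_density mu G0 (density mu G0) -> is_density mu G1 (density mu G1) ->
  (forall t : R, (H0 [set x | l x < t%:E] <= G0 [set x | l x < t%:E])%E) ->
  (forall t : R, (G1 [set x | l x < t%:E] <= H1 [set x | l x < t%:E])%E) ->
  (affinity mu u G0 G1 <= affinity mu u H0 H1)%E.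
Proof.
move=> dG0 dG1 H0G0 G1H1; have /andP[u0 u1] := u01.
have v0 : 0 < 1 - u by lra.
have [m0 g0 _] := dG0; have [m1 g1 _] := dG1.
have mlt (t : R) : measurable [set x | l x < t%:E]%E.
  by rewrite -[X in measurable X]setTI; exact: emeasurable_fun_infty_o.
have le0 : (\int[G0]_x (l x `^ u) <= affinity mu u H0 H1)%E.
  rewrite -affinity_likelihood_ratio0.
  apply: (@le_integral_power _ _ _ true) => // s s0.
  (* Passing to complements reverses the inequality for {l < s}. *)
  have -> : [set x | (s%:E < l x ?<= if true)%O] = ~` [set x | l x < s%:E]%E.
    by apply/seteqP; split => x /=; rewrite leNgt => /negP.
  rewrite (probability_setC G0)// (probability_setC H0)//.
  by rewrite leeB.
have le1 : (\int[G1]_x ((l x)^-1 `^ (1 - u)) <= affinity mu u H0 H1)%E.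
  rewrite -affinity_likelihood_ratio1.
  apply: (@le_integral_power _ _ _ false) => //.
    exact: measurable_inve.
  move=> s s0.
  have -> : [set x | (s%:E < (l x)^-1%E ?<= if false)%O] =
            [set x | l x < (s^-1)%:E]%E.
    by apply/seteqP; split => x /=;
      rewrite inve_pgt ?inE ?lee_fin ?(ltW s0)// inver gt_eqF.
  exact: G1H1.
apply: (@le_trans _ _ (\int[mu]_x
    (u%:E * ((l x)^-1 `^ (1 - u) * (density mu G1 x)%:E) +
     (1 - u)%:E * (l x `^ u * (density mu G0 x)%:E)))%E).
  apply: ge0_le_integral => //.
  - by move=> x _; rewrite lee_fin mulr_ge0 ?powR_ge0.
  - exact: measurable_affinity.
  - by apply: emeasurable_funD; apply: measurable_funeM;
      apply: emeasurable_funM => //; exact/measurable_EFinP.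
  - by move=> x _; apply: weighted_AGMe.
have mf1 : measurable_fun setT
    (fun x => (l x)^-1 `^ (1 - u) * (density mu G1 x)%:E)%E.
  by apply: emeasurable_funM => //; exact/measurable_EFinP.
have mf0 : measurable_fun setT
    (fun x => l x `^ u * (density mu G0 x)%:E)%E.
  by apply: emeasurable_funM => //; exact/measurable_EFinP.
have f10 x : (0 <= (l x)^-1 `^ (1 - u) * (density mu G1 x)%:E)%E.
  by rewrite mule_ge0 ?poweR_ge0 ?lee_fin.
have f00 x : (0 <= l x `^ u * (density mu G0 x)%:E)%E.
  by rewrite mule_ge0 ?poweR_ge0 ?lee_fin.
have uE0 : (0 <= u%:E)%E by rewrite lee_fin ltW.
have vE0 : (0 <= (1 - u)%:E)%E by rewrite lee_fin ltW.
rewrite ge0_integralD//; last first.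
- exact: measurable_funeM.
- by move=> x _; exact: mule_ge0.
- exact: measurable_funeM.
- by move=> x _; exact: mule_ge0.
rewrite !ge0_integralZl//.
rewrite -(ge0_integral_density dG1)//; last by move=> x; exact: poweR_ge0.
rewrite -(ge0_integral_density dG0)//; last by move=> x; exact: poweR_ge0.
apply: (@le_trans _ _
    (u%:E * affinity mu u H0 H1 + (1 - u)%:E * affinity mu u H0 H1)%E).
  by apply: leeD; exact: lee_wpmul2l.
(* The weights u and 1 - u sum to 1. *)
by rewrite -ge0_muleDl// -EFinD subrKC mul1e.
Qed.

End likelihood_ratio.
End affinity_of_LFD.

Theorem mainTheorem2 (d : measure_display) (Omega : measurableType d)
    (R : realType) (mu : {measure set Omega -> \bar R})
    (GG0 GG1 : set (probability Omega R))
    (dom0 : dominated mu GG0) (dom1 : dominated mu GG1)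
    (u : R) (Gbar0 Gbar1 : probability Omega R)
    (amr : is_AMR mu GG0 GG1 u Gbar0 Gbar1)
    (uniq : unique_maximizer mu GG0 GG1 u) :
  forall (Ghat0 Ghat1 : probability Omega R) (l : Omega -> \bar R),
    is_FMR mu GG0 GG1 Ghat0 Ghat1 l ->
    [/\ ae_eq mu [set: Omega] (density mu Ghat0) (density mu Gbar0),
        ae_eq mu [set: Omega] (density mu Ghat1) (density mu Gbar1) &
        is_FMR mu GG0 GG1 Gbar0 Gbar1 l].
Proof.
move=> Ghat0 Ghat1 l [hat0 hat1 lr fmr].
have [u01 _ barmax] := amr; have [bar0 bar1 _] := barmax.
have [ml _ _] := lr.
have hatmax : maximizes_affinity mu GG0 GG1 u Ghat0 Ghat1.
  split; [exact: hat0|exact: hat1|move=> H0 H1 GH0 GH1].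
  (* Maximality uses the FMR inequalities at sample size 1 only. *)
  apply: (affinity_le_LFD u01 (densityP dom0 hat0) (densityP dom1 hat1) lr
    (densityP dom0 GH0) (densityP dom1 GH1)) => t;
    have [le0 le1] := fmr 1%N t _ _ GH0 GH1.
    by rewrite -!(iid_law1 _ t ml).
  by rewrite -!(iid_law1 _ t ml).
have [e0 e1] := uniq _ _ _ _ hatmax barmax.
(* The two pairs now agree as measures, so the FMR inequalities transfer to the AMR pair at every
   sample size. *)
have E0 := eq_density_measure (densityP dom0 hat0) (densityP dom0 bar0) e0.
have E1 := eq_density_measure (densityP dom1 hat1) (densityP dom1 bar1) e1.
split=> //; split=> //; first exact: is_likelihood_ratio_ae_eq lr.
move=> n t G0 G1 GG0G0 GG1G1.
have mA := @measurable_product_below _ _ _ l n t ml.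
by rewrite -(eq_iid_law E0 mA) -(eq_iid_law E1 mA); exact: fmr.
Qed.
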